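(* Every irreducible triplet $\xi=(G,\mathcal{L},\mathcal{A})$ possesses an invariant (Barabanov) multinorm, i.e. there are norms $\|\cdot\|_i$ on $L_i$, $i=1,\dots,n$, such that for every $i=1,\dots,n$ and every $x\in L_i$ $$\max_{A_{ji}\in\mathcal{A}_{ji},\ j=1,\dots,n}\|A_{ji}x\|_j=\rho(\xi)\,\|x\|_i .$$
   Context: A triplet (system) $\xi=(G,\mathcal{L},\mathcal{A})$ consists of: a finite directed multigraph $G$ with vertices $1,\dots,n$ (loops and multiple edges allowed, finitely many edges); finite-dimensional real linear spaces $\mathcal{L}=(L_1,\dots,L_n)$, $L_i$ attached to vertex $i$ (some, but not all, of them may be $\{0\}$); and, for every edge from $i$ to $j$, a linear operator $A_{ji}:L_i\to L_j$. $\mathcal{A}_{ji}$ is the finite (possibly empty) family of operators of edges from $i$ to $j$, and $\mathcal{A}=\bigcup_{i,j}\mathcal{A}_{ji}$. A path $\alpha$ is a sequence of consecutive edges; $|\alpha|$ is its number of edges. For a path $i_1\to i_2\to\dots\to i_{k+1}$ with operators $A_{i_{s+1}i_s}$, $\Pi_\alpha=A_{i_{k+1}i_k}\cdots A_{i_2i_1}:L_{i_1}\to L_{i_{k+1}}$. A multinorm is a collection of norms $\|\cdot\|_i$ on $L_i$, $i=1,\dots,n$; for an operator $A:L_i\to L_j$, $\|A\|=\sup_{\|x\|_i=1}\|Ax\|_j$ ($0$ if $L_i=\{0\}$). The joint spectral radius is $\rho(\xi)=\lim_{k\to\infty}\max_{|\alpha|=k}\|\Pi_\alpha\|^{1/k}$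 (the limit exists and does not depend on the multinorm). A maximum of nonnegative numbers over an empty set is $0$. A triplet $\xi'=(G,\mathcal{L}',\mathcal{A}')$ (same multigraph, spaces not all zero) is embedded in $\xi$ if $L_i'\subset L_i$ is a subspace for each $i$ and for every edge from $i$ to $j$ its operator in $\xi'$ is the restriction $A_{ji}|_{L_i'}$, which maps $L_i'$ into $L_j'$. The embedding is strict if $L_i'\ne L_i$ for at least one $i$. $\xi$ is reducible if it has a strictly embedded triplet, and irreducible otherwise. *)

(* Defs.v *)
From HB Require Import structures.
From mathcomp Require Import all_boot all_order all_algebra.
From mathcomp Require Import all_classical all_reals all_analysis.
Set Implicit Arguments.
Unset Strict Implicit.
Unset Printing Implicit Defensive.
Import Order.TTheory GRing.Theory Num.Theory numFieldNormedType.Exports.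
Local Open Scope classical_set_scope.
Local Open Scope ring_scope.

(* [edge i j] indexes the edges from [i] to [j], so that loops and multiple
   edges are allowed. *)
Record multigraph := Multigraph {
  nvert : nat;
  edge : 'I_nvert -> 'I_nvert -> finType
}.

Record triplet (R : realType) (G : multigraph)
    (L : 'I_(nvert G) -> vectType R) := Triplet {
  oper : forall i j : 'I_(nvert G), edge i j -> 'Hom(L i, L j);
  triplet_neq0 : exists i : 'I_(nvert G), {: L i}%VS != 0%VS
}.

Section Paths.
Variable G : multigraph.

(* Paths from [i] to [j] with [k.+1] edges; the first component of a longer path
   is its first edge.  Only nonempty paths are needed: the joint spectral radius
   is a limit over path lengths. *)
Fixpoint gpath (k : nat) (i j : 'I_(nvert G)) : finType :=
  if k is k'.+1 then {l : 'I_(nvert G) & (edge i l * gpath k' l j)%type}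
  else edge i j.

Variables (R : realType) (L : 'I_(nvert G) -> vectType R) (xi : triplet L).

Fixpoint path_oper (k : nat) (i j : 'I_(nvert G)) :
    gpath k i j -> 'Hom(L i, L j) :=
  match k return gpath k i j -> 'Hom(L i, L j) with
  | 0%N => fun e => oper xi e
  | k'.+1 => fun p =>
      (path_oper (tagged p).2 \o oper xi (tagged p).1)%VF
  end.

End Paths.

Definition is_norm (R : realType) (V : lmodType R) (f : V -> R) : Prop :=
  [/\ forall x y : V, f (x + y) <= f x + f y,
      forall (a : R) (x : V), f (a *: x) = `|a| * f x,
      forall x : V, 0 <= f x
    & forall x : V, f x = 0 -> x = 0].

Record multinorm (R : realType) (G : multigraph)
    (L : 'I_(nvert G) -> vectType R) := Multinorm {
  mnorm : forall i : 'I_(nvert G), L i -> R;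
  mnormP : forall i : 'I_(nvert G), is_norm (@mnorm i)
}.

(* When [V] is trivial, the set is empty and [sup set0 = 0]. *)
Definition opnorm (R : realType) (V W : vectType R) (nV : V -> R) (nW : W -> R)
    (f : 'Hom(V, W)) : R :=
  sup [set nW (f x) | x in [set x : V | nV x = 1]].

Section JointSpectralRadius.
Variables (R : realType) (G : multigraph) (L : 'I_(nvert G) -> vectType R).

Definition max_path_norm (xi : triplet L) (N : multinorm L) (k : nat) : R :=
  \big[Num.max/0]_(i : 'I_(nvert G)) \big[Num.max/0]_(j : 'I_(nvert G))
    \big[Num.max/0]_(p : gpath k i j)
      opnorm (@mnorm _ _ _ N i) (@mnorm _ _ _ N j) (path_oper xi p).

(* The exponent is [1 / k.+1] because [max_path_norm xi N k] ranges over the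
   paths with [k.+1] edges. *)
Definition is_jsr (xi : triplet L) (rho : R) : Prop :=
  forall N : multinorm L,
    (max_path_norm xi N k `^ (k.+1%:R^-1)) @[k --> \oo] --> rho.

(* The limit common to all multinorms; the default value [0] would be taken
   only if there were no such limit. *)
Definition jsr (xi : triplet L) : R := xget 0 [set rho | is_jsr xi rho].

End JointSpectralRadius.

Section Reducibility.
Variables (R : realType) (G : multigraph) (L : 'I_(nvert G) -> vectType R).

(* The operators of [xi'] are the restrictions of those of [xi]; that the latter
   map [U i] into [U j] is forced by the codomains of the former. *)
Definition embedded (U : forall i : 'I_(nvert G), {vspace L i})
    (xi' : triplet (fun i => subvs_of (U i))) (xi : triplet L) : Prop :=
  forall (i j : 'I_(nvert G)) (e : edge i j) (x : subvs_of (U i)),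
    vsval (oper xi' e x) = oper xi e (vsval x).

Definition reducible (xi : triplet L) : Prop :=
  exists (U : forall i : 'I_(nvert G), {vspace L i})
         (xi' : triplet (fun i => subvs_of (U i))),
    embedded xi' xi /\ exists i : 'I_(nvert G), U i != {: L i}%VS.

Definition irreducible (xi : triplet L) : Prop := ~ reducible xi.

End Reducibility.

Definition invariant_multinorm (R : realType) (G : multigraph)
    (L : 'I_(nvert G) -> vectType R) (xi : triplet L) (N : multinorm L) : Prop :=
  forall (i : 'I_(nvert G)) (x : L i),
    \big[Num.max/0]_(j : 'I_(nvert G)) \big[Num.max/0]_(e : edge i j)
      mnorm N (oper xi e x) = jsr xi * mnorm N x.

(* Main.v *)
Require Import Defs.
From mathcomp Require Import all_boot all_order all_algebra.
From mathcomp Require Import all_classical all_reals all_analysis.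
From mathcomp Require Import ring lra.

(** An invariant multinorm is an eigenvector, for the eigenvalue [jsr xi], of the
    monotone homogeneous operator [transfer], which sends a family [f] of
    seminorms on the [L i] to the family [x |-> max_e f (A_e x)]. The eigenvector
    is built without knowing the joint spectral radius, and the eigenvalue is
    identified at the end.

    Irreducibility is used in one form only ([irreducible_norm_family]): a nonzero
    seminorm family with [f (A_e x) <= r * f x] consists of norms, because its
    kernels form an invariant family of subspaces.

    Let [rho] be the infimum of the [s >= 0] for which some nonzero seminorm
    family satisfies [transfer f <= s * f]. It is attained ([extremal_family]):
    for each [s > rho] the supremum of all normalised families of rate [s] still
    has rate [s], and these suprema decrease to a nonzero limit as [s] decreases
    to [rho]. Let [f] be such an extremal family, hence a family of norms. If
    [rho = 0], then [transfer f = 0] and [f] is an eigenvector. Otherwise the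
    families [rho^-n * transfer^n f] decrease, and their limit [B] satisfies
    [transfer B = rho * B] by continuity ([barabanov_limit_eigen]). If [B] were
    zero, then [transfer^n f <= (rho^n / 2) * f] for some [n], and a geometric sum
    of the iterates of [f] would have a rate below [rho] ([iterate_gt_half]). So
    [B] is nonzero ([barabanov_limit_neq0]), and again a family of norms.

    For an eigenvector [N] the maximum over the paths with [k] edges of
    [N (Pi x)] is exactly [rho^k * N x]. By equivalence of norms every multinorm
    then has maximal path norms within constant factors of [rho^k], so the limit
    defining the joint spectral radius exists and equals [rho] ([jsr_eigen]). *)

Set Implicit Arguments.
Unset Strict Implicit.
Unset Printing Implicit Defensive.
Import Order.TTheory GRing.Theory Num.Theory numFieldNormedType.Exports.
Local Open Scope classical_set_scope.
Local Open Scope ring_scope.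

(** * Seminorms on finite-dimensional spaces *)

Definition is_seminorm (R : realType) (V : lmodType R) (f : V -> R) : Prop :=
  [/\ forall x y : V, f (x + y) <= f x + f y,
      forall (a : R) (x : V), f (a *: x) = `|a| * f x
    & forall x : V, 0 <= f x].

Lemma is_norm_seminorm (R : realType) (V : lmodType R) (f : V -> R) :
  is_norm f -> is_seminorm f.
Proof. by case. Qed.

Section Seminorm.
Variables (R : realType) (V : lmodType R) (f : V -> R).
Hypothesis hf : is_seminorm f.

Lemma seminormD x y : f (x + y) <= f x + f y. Proof. by case: hf. Qed.
Lemma seminormZ a x : f (a *: x) = `|a| * f x. Proof. by case: hf. Qed.
Lemma seminorm_ge0 x : 0 <= f x. Proof. by case: hf. Qed.

Lemma seminorm0 : f 0 = 0.
Proof. by rewrite -(scale0r 0) seminormZ normr0 mul0r. Qed.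

Lemma seminormN x : f (- x) = f x.
Proof. by rewrite -scaleN1r seminormZ normrN normr1 mul1r. Qed.

Lemma seminorm_sum (I : finType) (F : I -> V) :
  f (\sum_i F i) <= \sum_i f (F i).
Proof.
elim/big_ind2: _ => [|x a y b xa yb|//]; first by rewrite seminorm0.
exact: le_trans (seminormD _ _) (lerD xa yb).
Qed.

Lemma seminorm_dist x y : `|f x - f y| <= f (x - y).
Proof.
rewrite ler_norml; apply/andP; split; last first.
  by rewrite lerBlDr -{1}(subrK y x) seminormD.
rewrite lerNl opprB lerBlDr -(seminormN (x - y)) opprB.
by rewrite -{1}(subrK x y) seminormD.
Qed.

End Seminorm.

Section Coordinates.
Variables (R : realType) (V : vectType R).
Local Notation n := (\dim {: V}).

Definition coords (x : V) : 'rV[R]_n := \row_i coord (vbasis {: V}) i x.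
Definition of_coords (v : 'rV[R]_n) : V := \sum_i v 0 i *: (vbasis {: V})`_i.

(** A linear size of a seminorm: it passes to limits, vanishes only with the
    seminorm, and bounds it by a multiple of the coordinate norm. *)
Definition basis_sum (f : V -> R) : R := \sum_(i < n) f (vbasis {: V})`_i.

Lemma coordsK : cancel coords of_coords.
Proof.
move=> x; rewrite [RHS](coord_vbasis (memvf x)); apply: eq_bigr => i _.
by rewrite mxE.
Qed.

Lemma of_coordsK : cancel of_coords coords.
Proof.
move=> v; apply/rowP => i; rewrite mxE coord_sum_free //.
exact: basis_free (vbasisP _).
Qed.

Lemma of_coordsD v w : of_coords (v + w) = of_coords v + of_coords w.
Proof.
by rewrite -big_split; apply: eq_bigr => i _; rewrite mxE scalerDl.
Qed.

Lemma of_coordsZ a v : of_coords (a *: v) = a *: of_coords v.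
Proof.
by rewrite scaler_sumr; apply: eq_bigr => i _; rewrite mxE scalerA.
Qed.

Lemma basis_sum_ge0 f : is_seminorm f -> 0 <= basis_sum f.
Proof. by move=> hf; apply: sumr_ge0 => i _; exact: seminorm_ge0. Qed.

Lemma entry_le_norm m (v : 'rV[R]_m) i : `|v 0 i| <= `|v|.
Proof.
rewrite [leRHS]/Num.norm /= mx_normrE.
exact: (le_bigmax _ (fun ij : 'I_1 * 'I_m => `|v ij.1 ij.2|) (0, i)).
Qed.

Lemma seminorm_of_coords_le f v :
  is_seminorm f -> f (of_coords v) <= basis_sum f * `|v|.
Proof.
move=> hf; apply: le_trans (seminorm_sum hf _) _.
rewrite mulr_suml; apply: ler_sum => i _; rewrite (seminormZ hf) mulrC.
by rewrite ler_wpM2l ?entry_le_norm ?seminorm_ge0.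
Qed.

Lemma seminorm_le_coords f x :
  is_seminorm f -> f x <= basis_sum f * `|coords x|.
Proof. by move=> hf; rewrite -{1}(coordsK x) seminorm_of_coords_le. Qed.

Lemma coords_norm : is_norm (fun x : V => `|coords x|).
Proof.
split => [x y|a x|x|x] //.
- have -> : coords (x + y) = coords x + coords y.
    by apply/rowP => i; rewrite !mxE linearD.
  exact: ler_normD.
- have -> : coords (a *: x) = a *: coords x.
    by apply/rowP => i; rewrite !mxE linearZ.
  exact: normrZ.
- move/normr0_eq0 => x0; rewrite -(coordsK x) x0.
  by rewrite /of_coords big1 // => i _; rewrite mxE scale0r.
Qed.

Lemma seminorm_of_coords f : is_seminorm f -> is_seminorm (f \o of_coords).
Proof.
move=> hf; split => [v w|a v|v] /=.
- by rewrite of_coordsD seminormD.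
- by rewrite of_coordsZ seminormZ.
- exact: seminorm_ge0.
Qed.

(** Continuity is meant for the topology of the coordinates, the [vectType]
    itself carrying none. *)
Lemma seminorm_continuous f : is_seminorm f -> continuous (f \o of_coords).
Proof.
move=> hf v.
apply/(@cvgrPdist_lt R R _ (nbhs v) (nbhs_filter v)) => e e0.
apply/(@nbhs_normP R 'rV[R]_n v); exists (e / (basis_sum f + 1)) => [|w /= vw].
  by rewrite /= divr_gt0 // ltr_wpDl ?basis_sum_ge0.
have hg := seminorm_of_coords hf.
apply: le_lt_trans (seminorm_dist hg _ _) _.
apply: le_lt_trans (seminorm_of_coords_le _ hf) _.
have b0 : 0 < basis_sum f + 1 by rewrite ltr_wpDl ?basis_sum_ge0.
apply: (@le_lt_trans _ _ ((basis_sum f + 1) * `|v - w|)).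
  by rewrite ler_wpM2r // lerDl.
by rewrite mulrC -ltr_pdivlMr.
Qed.

(** Equivalence of norms in finite dimension: the minimum of [f] on the compact
    unit sphere of the coordinates is positive. *)
Lemma coords_le_norm f : is_norm f ->
  exists2 C : R, 0 < C & forall x, `|coords x| <= C * f x.
Proof.
move=> nf; have hf := is_norm_seminorm nf.
pose S : set 'rV[R]_n := [set v | `|v| = 1].
(* the sphere is empty exactly when the space is trivial *)
have [S0|/set0P/negP/negPn/eqP S0] := pselect (S !=set0); last first.
  exists 1 => // x; rewrite mul1r; have [x0|x0] := eqVneq `|coords x| 0.
    by rewrite x0 seminorm_ge0.
  suff : S (`|coords x|^-1 *: coords x) by rewrite S0.
  by rewrite /S /= normrZ normfV normr_id mulVf.
have cS : compact S.
  apply: bounded_closed_compact.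
    by exists 1; split => // M M1 v; rewrite /S /= => ->; exact: ltW.
  have -> : S = Num.norm @^-1` [set 1 : R] by [].
  apply: closed_comp => [v _|]; [exact: norm_continuous|exact: closed_eq].
have cf : {within S, continuous (f \o of_coords)}.
  exact/continuous_subspaceT/seminorm_continuous.
have [c Sc cmin] := EVT_min_rV S0 cS cf.
have c1 : `|c| = 1 by move: Sc; rewrite inE.
have fc0 : 0 < f (of_coords c).
  rewrite lt_neqAle eq_sym seminorm_ge0 // andbT; apply/eqP.
  case: nf => _ _ _ nf0 /nf0 c0; move: c1; rewrite -(of_coordsK c) c0.
  rewrite (seminorm0 (is_norm_seminorm coords_norm)) => /esym/eqP.
  by rewrite oner_eq0.
exists (f (of_coords c))^-1 => [|x]; first by rewrite invr_gt0.
rewrite mulrC ler_pdivlMr //; have [x0|x0] := eqVneq `|coords x| 0.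
  by rewrite x0 mul0r seminorm_ge0.
have := cmin (`|coords x|^-1 *: coords x).
rewrite inE /S /= normrZ normfV normr_id mulVf // => /(_ erefl).
rewrite of_coordsZ coordsK seminormZ // normfV normr_id mulrC => h.
by rewrite mulrC -ler_pdivlMr // lt_neqAle eq_sym x0 normr_ge0.
Qed.

Lemma seminorm_le_norm (f g : V -> R) : is_norm f -> is_seminorm g ->
  exists2 C : R, 0 < C & forall x, g x <= C * f x.
Proof.
move=> nf hg; have [C C0 hC] := coords_le_norm nf.
exists ((basis_sum g + 1) * C) => [|x].
  by rewrite mulr_gt0 // ltr_wpDl ?basis_sum_ge0.
apply: le_trans (seminorm_le_coords x hg) _; rewrite -mulrA.
apply: ler_pM; rewrite ?basis_sum_ge0 ?normr_ge0 ?lerDl //.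
Qed.

End Coordinates.

(** A subspace of maximal dimension among those on which [P] holds contains every
    solution of [P], since it absorbs the line through any of them. *)
Lemma linear_pred_vspace (R : realType) (V : vectType R) (P : V -> Prop) :
    P 0 -> (forall x y, P x -> P y -> P (x + y)) ->
    (forall a x, P x -> P (a *: x)) ->
  exists U : {vspace V}, forall x, x \in U <-> P x.
Proof.
move=> P0 PD PZ.
pose Q d := `[< exists2 U : {vspace V},
  \dim U = d & forall x, x \in U -> P x >].
have exQ : exists d, Q d.
  exists 0%N; apply/asboolP; exists 0%VS; first exact: dimv0.
  by move=> x; rewrite memv0 => /eqP ->.
have ubQ d : Q d -> (d <= \dim {: V})%N.
  by move=> /asboolP[U <- _]; rewrite dimvS ?subvf.
have [d /asboolP[U dU UP] dmax] := ex_maxnP exQ ubQ.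
exists U => x; split => [/UP//|Px].
have QUx : Q (\dim (U + <[x]>)%VS).
  apply/asboolP; exists (U + <[x]>)%VS => // _ /memv_addP[u Uu [w wx ->]].
  by apply: PD; [exact: UP|case/vlineP: wx => a ->; exact: PZ].
have : U == (U + <[x]>)%VS by rewrite eqEdim addvSl /= dU dmax.
by move/eqP => ->; rewrite (subvP (addvSr U <[x]>%VS)) ?memv_line.
Qed.

(** * Families of seminorms over the vertices *)

Section Families.
Variables (R : realType) (G : multigraph) (L : 'I_(nvert G) -> vectType R).
Variable xi : triplet L.

Local Notation family := (forall i : 'I_(nvert G), L i -> R).

Definition seminorm_family (f : family) := forall i, is_seminorm (f i).

Definition growth_le (r : R) (f : family) :=
  forall i j (e : edge i j) x, f j (oper xi e x) <= r * f i x.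

(** In these terms an invariant multinorm is an eigenvector of [transfer] for
    the eigenvalue [jsr xi]. *)
Definition transfer (f : family) : family := fun i x =>
  \big[Num.max/0]_(j : 'I_(nvert G)) \big[Num.max/0]_(e : edge i j)
    f j (oper xi e x).

Definition total_basis_sum (f : family) : R := \sum_i basis_sum (f i).

Lemma total_basis_sum_ge0 f : seminorm_family f -> 0 <= total_basis_sum f.
Proof. by move=> hf; apply: sumr_ge0 => i _; exact: basis_sum_ge0. Qed.

Lemma seminorm_le_total f i x : seminorm_family f ->
  f i x <= total_basis_sum f * `|coords x|.
Proof.
move=> hf; apply: le_trans (seminorm_le_coords x (hf i)) _.
rewrite ler_wpM2r // /total_basis_sum (bigD1 i) //= lerDl.
by apply: sumr_ge0 => j _; exact: basis_sum_ge0.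
Qed.

Lemma total_basis_sum_eq0 f : seminorm_family f ->
  total_basis_sum f = 0 <-> forall i x, f i x = 0.
Proof.
move=> hf; split => [f0 i x|f0].
  apply/eqP; rewrite eq_le (seminorm_ge0 (hf i)) andbT.
  by have := seminorm_le_total x hf; rewrite f0 mul0r.
by rewrite /total_basis_sum big1 // => i _; apply: big1 => j _; exact: f0.
Qed.

(** The kernels of the seminorms are invariant under all the operators, hence
    form an embedded system; irreducibility leaves no room for a nonzero one. *)
Lemma irreducible_norm_family (r : R) f : irreducible xi ->
    seminorm_family f -> growth_le r f -> total_basis_sum f <> 0 ->
  forall i, is_norm (f i).
Proof.
move=> irr hf gf f_neq0.
have exU i : exists U : {vspace L i}, forall x, x \in U <-> f i x = 0.
  apply: linear_pred_vspace => [|x y x0 y0|a x x0].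
  - exact: (seminorm0 (hf i)).
  - apply/eqP; rewrite eq_le (seminorm_ge0 (hf i)) andbT.
    by apply: le_trans (seminormD (hf i) _ _) _; rewrite x0 y0 addr0.
  - by rewrite (seminormZ (hf i)) x0 mulr0.
pose U i := projT1 (cid (exU i)).
have UP i x : x \in U i <-> f i x = 0 by exact: (projT2 (cid (exU i))).
(* one nonzero kernel is enough: the spaces of a triplet must not all vanish *)
suff U0 i : U i = 0%VS.
  move=> i; have [fD fZ f0] := hf i; split => // x /UP.
  by rewrite U0 memv0 => /eqP.
apply/eqP; apply: contra_notT irr => Ui.
pose op i j (e : edge i j) : 'Hom(subvs_of (U i), subvs_of (U j)) :=
  (linfun (vsproj (U j)) \o oper xi e \o linfun vsval)%VF.
have nz : exists i, {: subvs_of (U i)}%VS != 0%VS.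
  by exists i; rewrite -dimv_eq0 dimvf /dim /= dimv_eq0.
exists U, (Triplet op nz); split => [j k e x|] /=.
  rewrite !comp_lfunE !lfunE /= vsprojK //; apply/UP/eqP.
  rewrite eq_le (seminorm_ge0 (hf k)) andbT.
  apply: le_trans (gf _ _ e _) _.
  by have /UP -> := subvsP x; rewrite mulr0.
apply/existsP; rewrite -negb_forall; apply: contra_notN f_neq0.
move=> /forallP /= Uf; apply/(total_basis_sum_eq0 hf) => j x; apply/UP.
by rewrite (eqP (Uf j)) memvf.
Qed.

Lemma le_transfer (f : family) i j (e : edge i j) x :
  f j (oper xi e x) <= transfer f x.
Proof.
apply: le_trans (le_bigmax _ (fun e : edge i j => f j (oper xi e x)) e) _.
exact: (le_bigmax _
  (fun j => \big[Num.max/0]_(e : edge i j) f j (oper xi e x)) j).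
Qed.

Lemma transfer_le (f : family) i x c : 0 <= c ->
  (forall j (e : edge i j), f j (oper xi e x) <= c) -> transfer f x <= c.
Proof.
by move=> c0 fc; apply: bigmax_le => // j _; apply: bigmax_le => // e _.
Qed.

Lemma transfer_ge0 (f : family) i (x : L i) : 0 <= transfer f x.
Proof. exact: bigmax_ge_id. Qed.

(** The value is positive, so it is not the default value [0] of the maximum. *)
Lemma transfer_attained (f : family) i (x : L i) : 0 < transfer f x ->
  exists j (e : edge i j), f j (oper xi e x) = transfer f x.
Proof.
move=> T0; apply: contrapT => none.
suff : transfer f x < transfer f x by rewrite ltxx.
apply: bigmax_lt => // j _; apply: bigmax_lt => // e _.
rewrite lt_neqAle le_transfer andbT; apply/eqP => fe.
by apply: none; exists j, e.
Qed.

Lemma transfer_growth (r : R) f i (x : L i) : 0 <= r -> seminorm_family f ->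
  growth_le r f -> transfer f x <= r * f i x.
Proof.
move=> r0 hf gf; apply: transfer_le => [|j e]; last exact: gf.
by rewrite mulr_ge0 ?(seminorm_ge0 (hf i)).
Qed.

Lemma transfer_mono f g : (forall i x, f i x <= g i x) ->
  forall i (x : L i), transfer f x <= transfer g x.
Proof.
move=> fg i x; apply: transfer_le => [|j e]; first exact: transfer_ge0.
exact: le_trans (fg _ _) (le_transfer g e x).
Qed.

Lemma transfer_seminorm f : seminorm_family f -> seminorm_family (transfer f).
Proof.
move=> hf i; have Z a (x : L i) : transfer f (a *: x) <= `|a| * transfer f x.
  apply: transfer_le => [|j e]; first by rewrite mulr_ge0 ?transfer_ge0.
  by rewrite linearZ (seminormZ (hf j)) ler_wpM2l ?le_transfer.
split => [x y|a x|x]; last exact: transfer_ge0.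
  apply: transfer_le => [|j e]; first by rewrite addr_ge0 ?transfer_ge0.
  rewrite linearD; apply: le_trans (seminormD (hf j) _ _) _.
  by rewrite lerD ?le_transfer.
apply/eqP; rewrite eq_le Z /=; have [->|a0] := eqVneq a 0.
  by rewrite normr0 mul0r transfer_ge0.
rewrite mulrC -ler_pdivlMr ?normr_gt0 // mulrC -normfV.
by apply: le_trans _ (Z _ _); rewrite scalerA mulVf // scale1r.
Qed.

(** * Nonincreasing limits of seminorm families *)

Section Limit.
Variable f : nat -> family.
Arguments f : clear implicits.
Hypothesis hf : forall n, seminorm_family (f n).
Hypothesis f_decr : forall n i x, f n.+1 i x <= f n i x.

Definition family_lim : family := fun i x => limn (fun n => f n i x).

Lemma family_decr i x : {homo (fun n => f n i x) : m n / (m <= n)%N >-> n <= m}.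
Proof. by apply/nonincreasing_seqP => n; exact: f_decr. Qed.

Lemma family_limP i x : f n i x @[n --> \oo] --> family_lim x.
Proof.
apply: nonincreasing_is_cvgn; first exact: family_decr.
by exists 0 => _ [n _ <-]; exact: (seminorm_ge0 (hf n i)).
Qed.

Lemma family_lim_seminorm : seminorm_family family_lim.
Proof.
move=> i; split => [x y|a x|x].
- have cD : f n i x + f n i y @[n --> \oo] --> family_lim x + family_lim y.
    by apply: cvgD; exact: family_limP.
  apply: ler_cvg_to (@family_limP i (x + y)) cD _.
  by near=> n; exact: (seminormD (hf n i)).
- apply: cvg_lim => //; under eq_fun do rewrite (seminormZ (hf _ i)).
  by apply: cvgMl_tmp; exact: family_limP.
- apply: ler_cvg_to (@cvg_cst _ 0 _ _ _) (@family_limP i x) _.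
  by near=> n; exact: (seminorm_ge0 (hf n i)).
Unshelve. all: by end_near.
Qed.

Lemma cvg_total_basis_sum :
  total_basis_sum (f n) @[n --> \oo] --> total_basis_sum family_lim.
Proof.
apply: (cvg_big add_continuous) => i _; apply: (cvg_big add_continuous) => k _.
exact: family_limP.
Qed.

Lemma cvg_transfer i (x : L i) :
  transfer (f n) x @[n --> \oo] --> transfer family_lim x.
Proof.
have cmax : continuous (fun p : R * R => Num.max p.1 p.2).
  by move=> p; apply: continuous_max; [exact: cvg_fst|exact: cvg_snd].
apply: (cvg_big cmax) => j _; apply: (cvg_big cmax) => e _.
exact: family_limP.
Qed.

End Limit.

End Families.

(** * An extremal family *)

Section ExtremalFamily.
Variables (R : realType) (G : multigraph) (L : 'I_(nvert G) -> vectType R).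
Variable xi : triplet L.

Local Notation family := (forall i : 'I_(nvert G), L i -> R).

(** The normalisation keeps suprema finite and keeps limits from vanishing. *)
Definition admissible (s : R) (f : family) :=
  [/\ seminorm_family f, total_basis_sum f = 1 & growth_le xi s f].

Definition growth_rates : set R :=
  [set s | 0 <= s /\ exists f, admissible s f].

Lemma admissible_le (s r : R) f : s <= r -> admissible s f -> admissible r f.
Proof.
move=> sr [hf f1 gf]; split => // i j e x.
by apply: le_trans (gf i j e x) _; rewrite ler_wpM2r ?(seminorm_ge0 (hf i)).
Qed.

Lemma growth_rates_normalize (s : R) f : 0 <= s -> seminorm_family f ->
  growth_le xi s f -> total_basis_sum f <> 0 -> growth_rates s.
Proof.
move=> s0 hf gf /eqP f0; split => //.
have fgt0 : 0 < total_basis_sum f by rewrite lt0r f0 total_basis_sum_ge0.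
have c0 : 0 <= (total_basis_sum f)^-1 by rewrite invr_ge0 ltW.
exists (fun i x => (total_basis_sum f)^-1 * f i x); split.
- move=> i; split => [x y|a x|x].
  + by rewrite -mulrDr ler_wpM2l // (seminormD (hf i)).
  + by rewrite (seminormZ (hf i)) mulrCA.
  + by rewrite mulr_ge0 ?(seminorm_ge0 (hf i)).
- rewrite -[RHS](mulVf f0) mulr_sumr; apply: eq_bigr => i _.
  by rewrite mulr_sumr.
- move=> i j e x; by rewrite mulrCA ler_wpM2l // gf.
Qed.

Lemma coords_family : seminorm_family (fun i (x : L i) => `|coords x|).
Proof. by move=> i; exact: is_norm_seminorm (coords_norm _). Qed.

Lemma norm_total_neq0 (f : family) :
  (forall i, is_norm (f i)) -> total_basis_sum f <> 0.
Proof.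
move=> nf /total_basis_sum_eq0 f0; have [i] := triplet_neq0 xi.
suff -> : {: L i}%VS = 0%VS by rewrite eqxx.
apply/vspaceP => x; rewrite memvf memv0; apply/esym/eqP.
have [_ _ _] := nf i; apply; apply: f0 => j.
exact: is_norm_seminorm.
Qed.

(** Constants indexed by the vertices can be replaced by their sum. *)
Lemma uniform_const (a b : family) : (forall i x, 0 <= b i x) ->
    (forall i, exists2 C : R, 0 < C & forall x, a i x <= C * b i x) ->
  exists2 C : R, 0 < C & forall i x, a i x <= C * b i x.
Proof.
move=> b0 ab; pose C i := s2val (cid2 (ab i)).
have C0 i : 0 < C i by exact: (s2valP (cid2 (ab i))).
have Cab i x : a i x <= C i * b i x by exact: (s2valP' (cid2 (ab i))).
exists (1 + \sum_i C i) => [|i x].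
  by rewrite ltr_wpDr // sumr_ge0 // => i _; exact: ltW.
apply: le_trans (Cab i x) _; rewrite ler_wpM2r // (bigD1 i) //= addrCA lerDl.
by rewrite addr_ge0 // sumr_ge0 // => j _; exact: ltW.
Qed.

(** The coordinate norms grow by a bounded factor: [transfer] turns them into
    seminorms, which they dominate. *)
Lemma growth_rates_nonempty : growth_rates !=set0.
Proof.
have [C C0 hC] : exists2 C : R, 0 < C & forall i (x : L i),
    transfer xi (fun j y => `|coords y|) x <= C * `|coords x|.
  apply: (@uniform_const _ (fun i x => `|coords x|)) => [//|i].
  apply: (seminorm_le_norm (coords_norm _)).
  exact: (transfer_seminorm xi coords_family).
exists C; apply: (growth_rates_normalize (ltW C0) coords_family).
  move=> i j e x; apply: le_trans (hC i x).
  exact: (le_transfer xi (fun j y => `|coords y|)).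
exact: norm_total_neq0 (fun i => coords_norm _).
Qed.

Lemma growth_rates_lb : has_lbound growth_rates.
Proof. by exists 0 => s []. Qed.

(** For irreducible [xi] this is the joint spectral radius, described without
    paths. *)
Definition extremal_rate : R := inf growth_rates.

Lemma extremal_rate_ge0 : 0 <= extremal_rate.
Proof. by apply: lb_le_inf growth_rates_nonempty _ => s []. Qed.

(** Taking the supremum instead of choosing one admissible family makes the
    result monotone in [s], so that the limit as [s] decreases needs no
    compactness. *)
Definition sup_admissible (s : R) : family :=
  fun i x => sup [set f i x | f in admissible s].

Section SupAdmissible.
Variable s : R.
Hypothesis adm_s : admissible s !=set0.

Lemma admissible_le_coords f i (x : L i) :
  admissible s f -> f i x <= `|coords x|.
Proof.
by case=> hf f1 _; have := seminorm_le_total x hf; rewrite f1 mul1r.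
Qed.

Lemma le_sup_admissible (f : family) i (x : L i) :
  admissible s f -> f i x <= sup_admissible s x.
Proof.
move=> af; apply: ub_le_sup; last by exists f.
by exists `|coords x| => _ [g ag <-]; exact: admissible_le_coords.
Qed.

Lemma sup_admissible_le i (x : L i) c :
  (forall f, admissible s f -> f i x <= c) -> sup_admissible s x <= c.
Proof.
move=> fc; apply: ge_sup => [|_ [f af <-]]; last exact: fc.
by have [f af] := adm_s; exists (f i x); exists f.
Qed.

Lemma sup_admissible_ge0 i (x : L i) : 0 <= sup_admissible s x.
Proof.
have [f af] := adm_s; apply: le_trans (le_sup_admissible x af).
by have [hf _ _] := af; exact: (seminorm_ge0 (hf i)).
Qed.

Lemma sup_admissible_seminorm : seminorm_family (sup_admissible s).
Proof.
move=> i.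
have Z a (x : L i) : sup_admissible s (a *: x) <= `|a| * sup_admissible s x.
  apply: sup_admissible_le => f af; have [hf _ _] := af.
  by rewrite (seminormZ (hf i)) ler_wpM2l ?le_sup_admissible.
split => [x y|a x|x]; last exact: sup_admissible_ge0.
  apply: sup_admissible_le => f af; have [hf _ _] := af.
  by apply: le_trans (seminormD (hf i) _ _) _; rewrite lerD ?le_sup_admissible.
apply/eqP; rewrite eq_le Z /=; have [->|a0] := eqVneq a 0.
  by rewrite normr0 mul0r sup_admissible_ge0.
rewrite mulrC -ler_pdivlMr ?normr_gt0 // mulrC -normfV.
by apply: le_trans _ (Z _ _); rewrite scalerA mulVf // scale1r.
Qed.

Lemma sup_admissible_growth : 0 <= s -> growth_le xi s (sup_admissible s).
Proof.
move=> s0 i j e x; apply: sup_admissible_le => f af; have [_ _ gf] := af.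
by apply: le_trans (gf i j e x) _; rewrite ler_wpM2l ?le_sup_admissible.
Qed.

Lemma sup_admissible_total : 1 <= total_basis_sum (sup_admissible s).
Proof.
have [f af] := adm_s; have [_ <- _] := af.
by apply: ler_sum => i _; apply: ler_sum => k _; exact: le_sup_admissible.
Qed.

End SupAdmissible.

(** The infimum of the growth rates is attained by the nonincreasing limit of
    [sup_admissible (extremal_rate + 1 / n.+1)]; the limit is nonzero because
    its [total_basis_sum] is a limit of numbers at least [1]. *)
Lemma extremal_family : exists f : family,
  [/\ seminorm_family f, growth_le xi extremal_rate f & total_basis_sum f <> 0].
Proof.
pose r n : R := extremal_rate + n.+1%:R^-1.
have r0 n : 0 <= r n by rewrite addr_ge0 ?extremal_rate_ge0.
have adm n : admissible (r n) !=set0.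
  have n0 : 0 < n.+1%:R^-1 :> R by rewrite invr_gt0.
  have [s [s0 [f af]] sr] :=
    inf_adherent n0 (conj growth_rates_nonempty growth_rates_lb).
  by exists f; apply: admissible_le (ltW sr) af.
pose g n := sup_admissible (r n).
have hg n : seminorm_family (g n) by exact: sup_admissible_seminorm.
have gdecr n i x : g n.+1 i x <= g n i x.
  apply: sup_admissible_le => // f af; apply: le_sup_admissible.
  by apply: admissible_le af; rewrite lerD2l lef_pV2 ?posrE ?ler_nat.
exists (family_lim g); split; first exact: family_lim_seminorm.
  have cr : r n @[n --> \oo] --> extremal_rate.
    rewrite -[X in _ --> X]addr0; apply: cvgD; first exact: cvg_cst.
    exact: cvg_harmonic.
  move=> i j e x.
  have crg : r n * g n i x @[n --> \oo] --> extremal_rate * family_lim g x.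
    by apply: cvgM cr _; exact: family_limP.
  apply: ler_cvg_to (@family_limP _ _ _ _ hg gdecr j (oper xi e x)) crg _.
  by near=> n; exact: sup_admissible_growth.
suff : 1 <= total_basis_sum (family_lim g).
  by move=> h g0; move: h; rewrite g0 ler10.
have c1 : (fun _ : nat => 1 : R) n @[n --> \oo] --> (1 : R) by exact: cvg_cst.
apply: ler_cvg_to c1 (@cvg_total_basis_sum _ _ _ _ hg gdecr) _.
by near=> n; exact: sup_admissible_total.
Unshelve. all: by end_near.
Qed.

End ExtremalFamily.
(** * The Barabanov family *)

Lemma bernoulli_le (R : realType) (a : R) n :
  0 <= a <= 1 -> 1 - n%:R * a <= (1 - a) ^+ n.
Proof.
move=> /andP[a0 a1]; elim: n => [|n IHn]; first by rewrite mul0r subr0 expr0.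
rewrite exprS; apply: le_trans (ler_wpM2l _ IHn); last by rewrite subr_ge0.
have : 0 <= n%:R * (a * a) by rewrite !mulr_ge0.
rewrite -natr1; nra.
Qed.

Section BarabanovFamily.
Variables (R : realType) (G : multigraph) (L : 'I_(nvert G) -> vectType R).
Variable xi : triplet L.
Hypothesis irr : irreducible xi.

Local Notation family := (forall i : 'I_(nvert G), L i -> R).
Local Notation rho := (extremal_rate xi).

Lemma growth_rates_ge_extremal s : growth_rates xi s -> rho <= s.
Proof. by move=> gs; apply: ge_inf gs; exact: growth_rates_lb. Qed.

Section Iterates.
Variable f : family.
Arguments f : clear implicits.
Hypothesis rho_gt0 : 0 < rho.
Hypothesis nf : forall i, is_norm (f i).
Hypothesis gf : growth_le xi rho f.

(** [rho^-n] times the [n]-th iterate of [transfer] on [f]. *)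
Definition iterate (n : nat) : family :=
  iter n (fun g i x => rho^-1 * transfer xi g x) f.

Lemma transfer_iterate n i (x : L i) :
  transfer xi (iterate n) x = rho * iterate n.+1 x.
Proof. by rewrite /iterate iterS mulrA divff ?mul1r // gt_eqF. Qed.

Lemma iterate_seminorm n : seminorm_family (iterate n).
Proof.
elim: n => [|n IHn] i; first exact: is_norm_seminorm.
have [TD TZ T0] := transfer_seminorm xi IHn i.
have c0 : 0 <= rho^-1 by rewrite invr_ge0 ltW.
split => [x y|a x|x]; rewrite /iterate !iterS.
- by rewrite -mulrDr ler_wpM2l ?TD.
- by rewrite TZ mulrCA.
- by rewrite mulr_ge0 ?T0.
Qed.

Lemma iterate_decr n i (x : L i) : iterate n.+1 x <= iterate n x.
Proof.
rewrite -(ler_pM2l rho_gt0) -transfer_iterate.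
elim: n i x => [|n IHn] i x.
  by apply: transfer_growth => //; [exact: ltW|exact: (iterate_seminorm 0)].
rewrite -transfer_iterate; apply: transfer_mono => j y.
by rewrite -(ler_pM2l rho_gt0) -transfer_iterate.
Qed.

(** The minimality of [rho] enters here. If [iterate n.+1] were at most half
    of [f], then for [q > 1] with [q ^+ n.+1 <= 2] the sum of the
    [q ^+ m * iterate m] over [m <= n] would grow at the rate [rho / q < rho]. *)
Lemma iterate_gt_half n :
  ~ forall i (x : L i), iterate n.+1 x <= 2^-1 * f i x.
Proof.
move=> half.
(* [q = (1 - a)^-1] satisfies [q ^+ n.+1 <= 2] by Bernoulli's inequality *)
pose a : R := (2 * n.+1%:R)^-1.
have a0 : 0 < a by rewrite invr_gt0 mulr_gt0.
have a_half : n.+1%:R * a = 2^-1.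
  by rewrite /a invfM mulrCA divff ?mulr1 // pnatr_eq0.
have a1 : a < 1.
  apply: (@le_lt_trans _ _ 2^-1); last by rewrite invf_lt1 ?ltr1n.
  by rewrite -a_half ler_peMl ?(ltW a0) // ler1n.
pose q := (1 - a)^-1.
have q0 : 0 < q by rewrite invr_gt0 subr_gt0.
have q_half : q ^+ n.+1 * 2^-1 <= 1.
  rewrite exprVn mulrC ler_pdivrMr ?exprn_gt0 ?subr_gt0 // mul1r.
  apply: le_trans (bernoulli_le n.+1 _); last by rewrite !ltW.
  by rewrite a_half; lra.
pose g : family := fun i x => \sum_(m < n.+1) q ^+ m * iterate m x.
have hi m := iterate_seminorm m.
have hg : seminorm_family g.
  move=> i; split => [x y|b x|x].
  - rewrite -big_split; apply: ler_sum => m _ /=; rewrite -mulrDr.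
    by rewrite ler_wpM2l ?exprn_ge0 ?(ltW q0) // (seminormD (hi m i)).
  - rewrite mulr_sumr; apply: eq_bigr => m _.
    by rewrite (seminormZ (hi m i)) mulrCA.
  - apply: sumr_ge0 => m _.
    by rewrite mulr_ge0 ?exprn_ge0 ?(ltW q0) // (seminorm_ge0 (hi m i)).
have s0 : 0 <= rho * (1 - a) by rewrite mulr_ge0 ?subr_ge0 ?ltW.
suff /growth_rates_ge_extremal : growth_rates xi (rho * (1 - a)).
  by rewrite ler_pMr // lerBrDr gerDl leNgt a0.
apply: (growth_rates_normalize s0 hg) => [i j e x|].
  (* the shifted sum gains [q ^+ n.+1 * iterate n.+1] and loses [f] *)
  apply: (@le_trans _ _
    (rho * (1 - a) * \sum_(m < n.+1) q ^+ m.+1 * iterate m.+1 x)).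
    rewrite mulr_sumr; apply: ler_sum => m _.
    have -> : rho * (1 - a) * (q ^+ m.+1 * iterate m.+1 x)
        = q ^+ m * (rho * iterate m.+1 x).
      rewrite exprS /q; have := a1; set c := 1 - a => c1.
      have c_neq0 : c != 0 by rewrite subr_eq0 gt_eqF.
      by field.
    rewrite ler_wpM2l ?exprn_ge0 ?(ltW q0) // -transfer_iterate.
    exact: le_transfer.
  rewrite ler_wpM2l // /g big_ord_recr big_ord_recl /= expr0 mul1r addrC.
  rewrite lerD2r; apply: le_trans (ler_wpM2l _ (half i x)) _.
    by rewrite exprn_ge0 ?ltW.
  by rewrite mulrA -[leRHS]mul1r ler_wpM2r // (seminorm_ge0 (hi 0 i)).
move/(total_basis_sum_eq0 hg) => g0; apply: (norm_total_neq0 xi nf).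
apply/(total_basis_sum_eq0 (iterate_seminorm 0)) => i x; apply/eqP.
rewrite eq_le (seminorm_ge0 (hi 0 i)) andbT -(g0 i x) /g big_ord_recl.
rewrite expr0 mul1r lerDl; apply: sumr_ge0 => m _.
by rewrite mulr_ge0 ?exprn_ge0 ?(ltW q0) // (seminorm_ge0 (hi _ i)).
Qed.

Definition barabanov_limit : family := family_lim iterate.

Lemma barabanov_limit_seminorm : seminorm_family barabanov_limit.
Proof. exact: (family_lim_seminorm iterate_seminorm iterate_decr). Qed.

(** Both sides are limits of the same sequence, since
    [transfer (iterate n) = rho * iterate n.+1]. *)
Lemma barabanov_limit_eigen i (x : L i) :
  transfer xi barabanov_limit x = rho * barabanov_limit x.
Proof.
have cT := @cvg_transfer _ _ _ xi _ iterate_seminorm iterate_decr i x.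
have cB : iterate n x @[n --> \oo] --> barabanov_limit x.
  exact: (@family_limP _ _ _ _ iterate_seminorm iterate_decr).
have cB' : transfer xi (iterate n) x @[n --> \oo] --> rho * barabanov_limit x.
  under eq_fun do rewrite transfer_iterate.
  apply: cvgMl_tmp.
  by have := cB; rewrite -(cvg_shiftS (fun n => iterate n x)).
exact: (cvg_unique _ cT cB').
Qed.

(** If the limit vanished, the iterates would tend to [0] at every basis vector,
    hence uniformly with respect to [f], against [iterate_gt_half]. *)
Lemma barabanov_limit_neq0 : total_basis_sum barabanov_limit <> 0.
Proof.
move=> B0.
have := @cvg_total_basis_sum _ _ _ _ iterate_seminorm iterate_decr.
rewrite -/barabanov_limit B0 => cS.
have [C C0 hC] : exists2 C : R, 0 < C & forall i (x : L i),
    `|coords x| <= C * f i x.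
  apply: uniform_const => [i x|i].
    exact: (seminorm_ge0 (iterate_seminorm 0 i)).
  exact: coords_le_norm.
have e0 : 0 < (2 * C)^-1 by rewrite invr_gt0 mulr_gt0.
have [n _ small] := @cvgr_le _ _ _ _ _ _ cS _ e0.
apply: (@iterate_gt_half n) => i x.
apply: le_trans (seminorm_le_total x (iterate_seminorm n.+1)) _.
apply: le_trans (ler_wpM2r _ (small n.+1 _)) _ => //=.
rewrite invfM -mulrA ler_wpM2l ?invr_ge0 //.
by rewrite mulrC ler_pdivrMr // mulrC.
Qed.

End Iterates.

Lemma barabanov_family : exists f : family, (forall i, is_norm (f i)) /\
  forall i (x : L i), transfer xi f x = rho * f i x.
Proof.
have [f [hf gf /(irreducible_norm_family irr hf gf) nf]] := extremal_family xi.
have [rho0|rho0] := leP rho 0.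
  (* for [rho = 0] the extremal family itself is annihilated by [transfer] *)
  exists f; split => // i x; have r0 : rho = 0.
    by apply/eqP; rewrite eq_le rho0 extremal_rate_ge0.
  apply/eqP; rewrite eq_le transfer_growth ?extremal_rate_ge0 //=.
  by rewrite r0 mul0r transfer_ge0.
exists (barabanov_limit f); split; last exact: barabanov_limit_eigen.
apply: (irreducible_norm_family (r := rho) irr).
- exact: barabanov_limit_seminorm.
- move=> i j e x; rewrite -barabanov_limit_eigen //.
  exact: (le_transfer xi (barabanov_limit f)).
- exact: barabanov_limit_neq0.
Qed.

End BarabanovFamily.

(** * Operator norms and the joint spectral radius *)

Section OperatorNorm.
Variables (R : realType) (V W : vectType R) (nV : V -> R) (nW : W -> R).
Hypotheses (hV : is_norm nV) (hW : is_norm nW).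
Variable f : 'Hom(V, W).

Lemma opnorm_le K : 0 <= K -> (forall x, nW (f x) <= K * nV x) ->
  opnorm nV nW f <= K.
Proof.
move=> K0 fK; rewrite /opnorm; set S := (X in sup X).
have [S0|/set0P/negP/negPn/eqP ->] := pselect (S !=set0); last by rewrite sup0.
by apply: ge_sup S0 _ => _ [x /= x1 <-]; rewrite -[K]mulr1 -x1.
Qed.

(** A supremum is an upper bound only for bounded sets; the operator is bounded
    because [nW \o f] is a seminorm, dominated by [nV]. *)
Lemma le_opnorm x : nW (f x) <= opnorm nV nW f * nV x.
Proof.
have sW := is_norm_seminorm hW; have sV := is_norm_seminorm hV.
have sWf : is_seminorm (nW \o f).
  split => [y z|a y|y] /=; last exact: (seminorm_ge0 sW).
  - by rewrite linearD (seminormD sW).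
  - by rewrite linearZ (seminormZ sW).
have [C C0 hC] := seminorm_le_norm hV sWf.
have [x0|x0] := eqVneq (nV x) 0.
  have [_ _ _ /(_ _ x0) ->] := hV.
  by rewrite linear0 (seminorm0 sW) (seminorm0 sV) mulr0.
have nx : 0 < nV x by rewrite lt0r x0 (seminorm_ge0 sV).
rewrite -ler_pdivrMr // mulrC.
have -> : (nV x)^-1 * nW (f x) = nW (f ((nV x)^-1 *: x)).
  by rewrite linearZ (seminormZ sW) ger0_norm // invr_ge0 ltW.
apply: ub_le_sup; last first.
  exists ((nV x)^-1 *: x) => //=.
  by rewrite (seminormZ sV) ger0_norm ?invr_ge0 ?(ltW nx) // mulVf.
by exists C => _ [y /= y1 <-]; rewrite -[C]mulr1 -y1; exact: hC.
Qed.

End OperatorNorm.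

Lemma cvg_root1 (R : realType) (C : R) : 0 < C ->
  C `^ (n.+1%:R^-1) @[n --> \oo] --> (1 : R).
Proof.
move=> C0; have clog : n.+1%:R^-1 * ln C @[n --> \oo] --> (0 : R).
  rewrite -[X in _ --> X](mul0r (ln C)).
  by apply: cvgMr_tmp; exact: cvg_harmonic.
rewrite /powR gt_eqF // -[X in _ --> X]expR0.
by apply: continuous_cvg; first exact: continuous_expR.
Qed.

Lemma root_scaled_power (R : realType) (C rho : R) n : 0 <= C -> 0 <= rho ->
  (C * rho ^+ n.+1) `^ (n.+1%:R^-1) = C `^ (n.+1%:R^-1) * rho.
Proof.
move=> C0 rho0; rewrite powRM ?exprn_ge0 //; congr (_ * _).
by rewrite -powR_mulrn // -powRrM divff ?pnatr_eq0 // powRr1.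
Qed.

Section EigenMultinorm.
Variables (R : realType) (G : multigraph) (L : 'I_(nvert G) -> vectType R).
Variables (xi : triplet L) (rho : R) (N : multinorm L).
Hypothesis rho_ge0 : 0 <= rho.
Hypothesis eigen :
  forall i (x : L i), transfer xi (mnorm N) x = rho * mnorm N x.

Let sN (M : multinorm L) : seminorm_family (@mnorm _ _ _ M).
Proof. by move=> i; exact: is_norm_seminorm (mnormP M i). Qed.

Lemma path_norm_le k i j (p : gpath k i j) (x : L i) :
  mnorm N (path_oper xi p x) <= rho ^+ k.+1 * mnorm N x.
Proof.
elim: k i j p x => [|k IHk] i j p x /=.
  by rewrite expr1 -eigen (le_transfer xi (@mnorm _ _ _ N)).
rewrite comp_lfunE; apply: le_trans (IHk _ _ _ _) _.
rewrite (exprSr rho k.+1) -mulrA ler_wpM2l ?exprn_ge0 // -eigen.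
exact: (le_transfer xi (@mnorm _ _ _ N)).
Qed.

Lemma path_norm_attained k i (x : L i) : 0 < rho -> 0 < mnorm N x ->
  exists j (p : gpath k i j),
    mnorm N (path_oper xi p x) = rho ^+ k.+1 * mnorm N x.
Proof.
move=> rho0; elim: k i x => [|k IHk] i x x0.
  have [|j [e fe]] := @transfer_attained _ _ _ xi (@mnorm _ _ _ N) i x.
    by rewrite eigen mulr_gt0.
  by exists j, e; rewrite /= fe eigen expr1.
have [|l [e fe]] := @transfer_attained _ _ _ xi (@mnorm _ _ _ N) i x.
  by rewrite eigen mulr_gt0.
have [|j [p fp]] := IHk l (oper xi e x); first by rewrite fe eigen mulr_gt0.
exists j, (Tagged (fun l => (edge i l * gpath k l j)%type) (e, p)).
by rewrite /= comp_lfunE /= fp fe eigen mulrA -exprSr.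
Qed.

Lemma max_path_norm_le (M : multinorm L) k c : 0 <= c ->
  (forall i j (p : gpath k i j),
     opnorm (@mnorm _ _ _ M i) (@mnorm _ _ _ M j) (path_oper xi p) <= c) ->
  max_path_norm xi M k <= c.
Proof.
move=> c0 pc; apply: bigmax_le => // i _; apply: bigmax_le => // j _.
exact: bigmax_le.
Qed.

Lemma le_max_path_norm (M : multinorm L) k i j (p : gpath k i j) :
  opnorm (@mnorm _ _ _ M i) (@mnorm _ _ _ M j) (path_oper xi p)
    <= max_path_norm xi M k.
Proof.
apply: le_trans (le_bigmax _ (fun i => \big[Num.max/0]_j
  \big[Num.max/0]_(p : gpath k i j) opnorm (@mnorm _ _ _ M i)
    (@mnorm _ _ _ M j) (path_oper xi p)) i).
apply: le_trans (le_bigmax _ (fun j => \big[Num.max/0]_(p : gpath k i j)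
  opnorm (@mnorm _ _ _ M i) (@mnorm _ _ _ M j) (path_oper xi p)) j).
exact: (le_bigmax _ (fun p : gpath k i j =>
  opnorm (@mnorm _ _ _ M i) (@mnorm _ _ _ M j) (path_oper xi p))).
Qed.

Lemma norms_equivalent (M M' : multinorm L) :
  exists2 C : R, 0 < C & forall i (x : L i), mnorm M' x <= C * mnorm M x.
Proof.
apply: uniform_const => [i x|i]; first exact: (seminorm_ge0 (sN M i)).
exact: seminorm_le_norm (mnormP M i) (sN M' i).
Qed.

Lemma max_path_norm_upper (M : multinorm L) :
  exists2 C : R, 0 < C & forall k, max_path_norm xi M k <= C * rho ^+ k.+1.
Proof.
have [C C0 MN] := norms_equivalent N M.
have [D D0 NM] := norms_equivalent M N.
exists (C * D) => [|k]; first exact: mulr_gt0.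
have K0 : 0 <= C * D * rho ^+ k.+1.
  by rewrite mulr_ge0 ?exprn_ge0 // ltW // mulr_gt0.
apply: max_path_norm_le => // i j p; apply: opnorm_le => // x.
apply: le_trans (MN _ _) _; rewrite -!mulrA ler_wpM2l ?(ltW C0) //.
apply: le_trans (path_norm_le p x) _.
by rewrite mulrCA ler_wpM2l ?exprn_ge0.
Qed.

(** If [rho] is positive, a vector with [0 < mnorm N x] is expanded by exactly
    [rho ^+ k.+1] along some path of each length. *)
Lemma max_path_norm_lower (M : multinorm L) :
  exists2 c : R, 0 < c & forall k, c * rho ^+ k.+1 <= max_path_norm xi M k.
Proof.
have M0 k : 0 <= max_path_norm xi M k by exact: bigmax_ge_id.
have [rho0|rho0] := leP rho 0.
  have r0 : rho = 0 by apply/eqP; rewrite eq_le rho0.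
  by exists 1 => // k; rewrite r0 expr0n mulr0.
have [i [x x0]] : exists i (x : L i), 0 < mnorm N x.
  apply: contrapT => none; apply: (norm_total_neq0 xi (mnormP N)).
  apply/(total_basis_sum_eq0 (sN N)) => i x; apply/eqP.
  rewrite eq_le (seminorm_ge0 (sN N i)) andbT leNgt; apply/negP => x0.
  by apply: none; exists i, x.
have Mx0 : 0 < mnorm M x.
  rewrite lt0r (seminorm_ge0 (sN M i)) andbT; apply/eqP.
  have [_ _ _ Mx /Mx xx] := mnormP M i.
  by move: x0; rewrite xx (seminorm0 (sN N i)) ltxx.
have [C C0 NM] := norms_equivalent M N.
exists (C^-1 * mnorm N x / mnorm M x) => [|k].
  by rewrite divr_gt0 // mulr_gt0 ?invr_gt0.
have [j [p fp]] := path_norm_attained k rho0 x0.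
apply: le_trans (le_max_path_norm M p).
have := le_opnorm (mnormP M i) (mnormP M j) (path_oper xi p) x.
rewrite -ler_pdivrMr //; apply: le_trans.
rewrite mulrAC ler_pM2r ?invr_gt0 // -mulrA ler_pdivrMl // mulrC -fp.
exact: NM.
Qed.

(** All multinorms are equivalent to the eigenvector [N], so their maximal path
    norms lie between two positive multiples of [rho ^+ k.+1], whose roots tend
    to [rho]. This proves that the limit defining the radius exists. *)
Lemma eigen_is_jsr : is_jsr xi rho.
Proof.
move=> M; have [C C0 up] := max_path_norm_upper M.
have [c c0 lo] := max_path_norm_lower M.
have cvg_const D : 0 < D ->
    (D * rho ^+ k.+1) `^ (k.+1%:R^-1) @[k --> \oo] --> rho.
  move=> D0.
  rewrite (_ : (fun k => _) = (fun k : nat => D `^ (k.+1%:R^-1) * rho)).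
    rewrite -{2}[rho]mul1r; apply: cvgMr_tmp; exact: cvg_root1.
  by apply/funext => k; rewrite root_scaled_power // ltW.
apply: (squeeze_cvgr _ (cvg_const c c0) (cvg_const C C0)).
near=> k; have ci : 0 <= c * rho ^+ k.+1.
  by rewrite mulr_ge0 ?exprn_ge0 // ltW.
have M0 : 0 <= max_path_norm xi M k := le_trans ci (lo k).
apply/andP; split; apply: ge0_ler_powR => //; rewrite ?nnegrE ?invr_ge0 //.
exact: le_trans M0 (up k).
Unshelve. all: by end_near.
Qed.

Lemma jsr_eigen : jsr xi = rho.
Proof.
apply: xget_unique => [|r hr]; first exact: eigen_is_jsr.
exact: (cvg_unique _ (hr N) (eigen_is_jsr N)).
Qed.

End EigenMultinorm.

Theorem theorem3 (R : realType) (G : multigraph)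
    (L : 'I_(nvert G) -> vectType R) (xi : triplet L)
    (hxi : irreducible xi) :
  exists N : multinorm L, invariant_multinorm xi N.
Proof.
have [f [nf eigen_f]] := barabanov_family hxi.
exists (Multinorm nf) => i x.
rewrite (jsr_eigen (N := Multinorm nf) (extremal_rate_ge0 xi) eigen_f).
exact: eigen_f.
Qed.
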